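(* Let $n=4k+7$ and $m=2k+3$, where $k\ge 2$. Then $\mathcal{A}_m:=\bigcup_{i=1}^{10}\mathcal{B}_i$ is an $m$-bicommutative system in $\mathcal{P}_n(m)$.
   Context: Write $[a]=\{1,\dots,a\}$ and $[a,b]=\{a,a+1,\dots,b\}$. $\mathcal{P}_n(m)$ is the collection of all subsets of $[n]$ of size $m$. An $s$-bicommutative system in $\mathcal{P}_n(s)$ is a collection $T\subseteq\mathcal{P}_n(s)$ such that (i) any two elements of $T$ have nonempty intersection, and (ii) for every $S_0\in\mathcal{P}_n(s)$ with $S_0\notin T$ there is $S_1\in T$ with $S_0\cap S_1=\emptyset$. With $n=4k+7$, $m=2k+3$, put $\mathcal{S}'_7=[4k+1,4k+7]$, so $[n]=\mathcal{S}'_7\cup[4k]$. Define the following seven triples in $\mathcal{S}'_7$: $L_1=\{4k+1,4k+2,4k+5\}$, $L_2=\{4k+1,4k+3,4k+6\}$, $L_3=\{4k+1,4k+4,4k+7\}$, $L_4=\{4k+2,4k+3,4k+7\}$, $L_5=\{4k+3,4k+4,4k+5\}$, $L_6=\{4k+5,4k+6,4k+7\}$, $L_7=\{4k+2,4k+4,4k+6\}$. The collections $\mathcal{B}_i\subset\mathcal{P}_n(m)$ (all members have size $m=2k+3$) are: for $1\le i\le 7$, $\mathcal{B}_i=\{L_i\cup S'\mid S'\subset[4k],\ |S'|=2k\}$; $\mathcal{B}_8=\{S'\cup S''\mid S'\subset\mathcal{S}'_7,\ S''\subset[4k],\ |S'|=2,\ |S''|=2k+1\}$; $\mathcal{B}_9=\{S'\cup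 S''\mid S'\subset\mathcal{S}'_7,\ S''\subset[4k],\ |S'|=1,\ |S''|=2k+2\}$; $\mathcal{B}_{10}=\{S\mid S\subset[4k],\ |S|=2k+3\}$. *)

(* Defs.v *)
From mathcomp Require Import all_boot.

Set Implicit Arguments.
Unset Strict Implicit.
Unset Printing Implicit Defensive.

(* The ground set [n] = {1, ..., n} is 'I_n with the ordinal i carrying the
   label i.+1; every set below is given by its labels. *)
Definition labelled (n : nat) (s : seq nat) : {set 'I_n} :=
  [set i : 'I_n | i.+1 \in s].

Definition interval (n a b : nat) : {set 'I_n} :=
  [set i : 'I_n | a <= i.+1 <= b].

Definition subsets_of_size (n : nat) (X : {set 'I_n}) (s : nat) :
    {set {set 'I_n}} :=
  [set S : {set 'I_n} | (S \subset X) && (#|S| == s)].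

Definition P (n s : nat) : {set {set 'I_n}} := subsets_of_size [set: 'I_n] s.

Definition bicommutative_system (n s : nat) (T : {set {set 'I_n}}) : Prop :=
  [/\ T \subset P n s,
      forall S0 S1 : {set 'I_n}, S0 \in T -> S1 \in T -> S0 :&: S1 <> set0
    & forall S0 : {set 'I_n}, S0 \in P n s -> S0 \notin T ->
        exists2 S1 : {set 'I_n}, S1 \in T & S0 :&: S1 = set0].

Definition S7 (k : nat) : {set 'I_(4 * k + 7)} :=
  interval (4 * k + 7) (4 * k + 1) (4 * k + 7).

Definition I4k (k : nat) : {set 'I_(4 * k + 7)} :=
  interval (4 * k + 7) 1 (4 * k).

(* The lines of a Fano plane on S7; only indices 1 to 7 are meaningful. *)
Definition L (k i : nat) : {set 'I_(4 * k + 7)} :=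
  labelled (4 * k + 7)
    match i with
    | 1 => [:: 4 * k + 1; 4 * k + 2; 4 * k + 5]
    | 2 => [:: 4 * k + 1; 4 * k + 3; 4 * k + 6]
    | 3 => [:: 4 * k + 1; 4 * k + 4; 4 * k + 7]
    | 4 => [:: 4 * k + 2; 4 * k + 3; 4 * k + 7]
    | 5 => [:: 4 * k + 3; 4 * k + 4; 4 * k + 5]
    | 6 => [:: 4 * k + 5; 4 * k + 6; 4 * k + 7]
    | 7 => [:: 4 * k + 2; 4 * k + 4; 4 * k + 6]
    | _ => [::]
    end.

(* Only indices 1 to 10 are meaningful. *)
Definition B (k i : nat) : {set {set 'I_(4 * k + 7)}} :=
  match i with
  | 1 | 2 | 3 | 4 | 5 | 6 | 7 =>
      [set L k i :|: S' | S' in subsets_of_size (I4k k) (2 * k)]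
  | 8 => [set S' :|: S'' | S' in subsets_of_size (S7 k) 2,
                           S'' in subsets_of_size (I4k k) (2 * k + 1)]
  | 9 => [set S' :|: S'' | S' in subsets_of_size (S7 k) 1,
                           S'' in subsets_of_size (I4k k) (2 * k + 2)]
  | 10 => subsets_of_size (I4k k) (2 * k + 3)
  | _ => set0
  end.

Definition A (k : nat) : {set {set 'I_(4 * k + 7)}} :=
  \bigcup_(1 <= i < 11) B k i.

(* Main.v *)
Require Import Defs.
From mathcomp Require Import all_boot.
From mathcomp Require Import zify.

(** Write the ground set as the disjoint union of the seven-point set [S7],
    which the triples [L] make into a Fano plane, and of the [4k] points of
    [I4k].  The system is best described by traces on the plane: an [m]-set
    belongs to it exactly when its trace on [S7] is a line or has at most two
    points ([in_A]).

    Two members meet: two lines of a Fano plane share a point, and if one of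
    the traces has at most two points then the parts of the members in [I4k]
    have together at least [2k + (2k + 1)] points, too many to be disjoint.

    An [m]-set [S] outside the system has a trace of at least three points
    which is not a line.  The complement of [S] has [m + 1] points, so a member
    disjoint from [S] is that complement with one point removed.  If the trace
    of [S] has at least four points, the complement has at most three points in
    the plane; remove one of them if there is any, and at most two are left.
    If the trace has three points, these are not collinear, and some
    line avoids them ([fano_avoid]): the complement has four points in the
    plane, three of them on that line, and the fourth one is removed. *)

(** * The Fano plane on 0, ..., 6 *)

(** The point [a] stands for the label [4 * k + a.+1], so that these are the
    triples [L k i] freed from [k], in a form open to computation. *)
Definition fano (i : nat) : seq nat :=
  match i with
  | 1 => [:: 0; 1; 4]
  | 2 => [:: 0; 2; 5]
  | 3 => [:: 0; 3; 6]
  | 4 => [:: 1; 2; 6]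
  | 5 => [:: 2; 3; 4]
  | 6 => [:: 4; 5; 6]
  | 7 => [:: 1; 3; 5]
  | _ => [::]
  end.

Lemma card_ord_pred n (p : pred nat) :
  #|[set j : 'I_n | p j]| = count p (iota 0 n).
Proof.
rewrite -sum1_card -sum1_count -[in iota 0 n](subn0 n).
by rewrite (big_mkord p (fun=> 1)); apply: eq_bigl => j; rewrite inE.
Qed.

Lemma fano_lt7 i a : a \in fano i -> a < 7.
Proof.
by move: i => [|[|[|[|[|[|[|[|i]]]]]]]] //; rewrite !inE => /or3P[] /eqP->.
Qed.

Lemma fano_meet i j :
  1 <= i <= 7 -> 1 <= j <= 7 -> exists2 a, a \in fano i & a \in fano j.
Proof.
move=> hi hj; apply/hasP; rewrite has_sym.
by move: i hi => [|[|[|[|[|[|[|[|i]]]]]]]] //; move: j hj => [|[|[|[|[|[|[|[|j]]]]]]]].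
Qed.

(** Three points that are not collinear span three lines, and each of them is
    on one further line; this makes six lines, so one of the seven avoids all
    three points.  The proof inspects all subsets of the plane. *)
Lemma fano_avoid (p : pred nat) : count p (iota 0 7) = 3 ->
  exists2 i, 1 <= i <= 7 &
    {in fano i, forall a, p a} \/ {in fano i, forall a, ~~ p a}.
Proof.
move=> h3.
have /hasP[i]: has (fun i => all p (fano i) || all (predC p) (fano i)) (iota 1 7).
  move: h3 => /=.
  by case: (p 0); case: (p 1); case: (p 2); case: (p 3); case: (p 4);
     case: (p 5); case: (p 6).
rewrite mem_iota => hi /orP[] /allP h; exists i => //; [by left | by right].
Qed.

(** * The plane inside the ground set *)

Section Plane.

Variable k : nat.
Implicit Types S : {set 'I_(4 * k + 7)}.

Definition point (j : 'I_7) : 'I_(4 * k + 7) := rshift (4 * k) j.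

Lemma point_inj : injective point.
Proof. exact: rshift_inj. Qed.

Lemma I4kE : I4k k = ~: S7 k.
Proof. by apply/setP=> x; rewrite !inE; have := ltn_ord x; lia. Qed.

Lemma S7E : S7 k = point @: [set: 'I_7].
Proof.
apply/setP=> x; rewrite inE; apply/idP/imsetP=> [hx|[j _ ->] /=].
  have hj : x - 4 * k < 7 by have := ltn_ord x; lia.
  by exists (Ordinal hj) => //; apply: val_inj => /=; lia.
by have := ltn_ord j; lia.
Qed.

Lemma card_S7 : #|S7 k| = 7.
Proof. by rewrite S7E card_imset ?cardsT ?card_ord //; exact: point_inj. Qed.

Lemma card_I4k : #|I4k k| = 4 * k.
Proof. by have := cardsC (S7 k); rewrite -I4kE card_S7 card_ord; lia. Qed.

Lemma card_split S : #|S :&: S7 k| + #|S :&: I4k k| = #|S|.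
Proof. by rewrite I4kE -setDE cardsID. Qed.

Lemma LE i : L k i = point @: [set j : 'I_7 | val j \in fano i].
Proof.
have -> : L k i = labelled (4 * k + 7) [seq 4 * k + a.+1 | a <- fano i].
  by move: i => [|[|[|[|[|[|[|[|i]]]]]]]].
apply/setP=> x; rewrite inE; apply/mapP/imsetP=> [[a ha]|[j]].
  have a7 := fano_lt7 _ _ ha.
  by exists (Ordinal a7); rewrite ?inE //; apply: val_inj => /=; lia.
by rewrite inE => hj ->; exists (val j) => //=; lia.
Qed.

Lemma L_sub i : L k i \subset S7 k.
Proof. by rewrite LE S7E imsetS // subsetT. Qed.

Lemma card_L i : 1 <= i <= 7 -> #|L k i| = 3.
Proof.
move=> hi; rewrite LE card_imset; last exact: point_inj.
rewrite (card_ord_pred _ (fun a => a \in fano i)).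
by move: i hi => [|[|[|[|[|[|[|[|i]]]]]]]].
Qed.

Lemma L_meet i j : 1 <= i <= 7 -> 1 <= j <= 7 ->
  exists2 x, x \in L k i & x \in L k j.
Proof.
move=> hi hj; have [a ai aj] := fano_meet _ _ hi hj.
have a7 := fano_lt7 _ _ ai.
exists (point (Ordinal a7));
  by rewrite LE mem_imset ?inE //; exact: point_inj.
Qed.

Lemma L_avoid S : #|S :&: S7 k| = 3 ->
  exists2 i, 1 <= i <= 7 & S :&: S7 k = L k i \/ L k i \subset ~: S.
Proof.
pose p a := point (inord a) \in S.
have pE (j : 'I_7) : p j = (point j \in S) by rewrite /p inord_val.
have trE : S :&: S7 k = point @: [set j : 'I_7 | p j].
  apply/setP=> x; rewrite inE S7E andbC.
  apply/andP/imsetP=> [[/imsetP[j _ ->] hS]|[j]].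
    by exists j; rewrite // inE pE.
  by rewrite inE pE => hj ->; rewrite imset_f.
move=> h3; have [] := fano_avoid p.
  by rewrite -card_ord_pred -(card_imset _ point_inj) -trE.
move=> i hi [hp|hp]; exists i => //; [left | right].
  apply/esym/eqP; rewrite eqEcard card_L // h3 leqnn andbT LE trE.
  by apply/imsetS/subsetP=> j; rewrite !inE; exact: hp.
rewrite LE; apply/subsetP=> _ /imsetP[j hj ->].
by move: hj; rewrite inE in_setC -pE; exact: hp.
Qed.

(** * The system in terms of traces on the plane *)

(** Since [S7] and [I4k] partition the ground set, a union of a part of the one
    and a part of the other determines both parts.  This is how the families
    [B k i] become conditions on traces. *)
Lemma in_glue (F G : {set {set 'I_(4 * k + 7)}}) S :
  (forall U, U \in F -> U \subset S7 k) ->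
  (forall V, V \in G -> V \subset I4k k) ->
  (S \in [set U :|: V | U in F, V in G]) =
    (S :&: S7 k \in F) && (S :&: I4k k \in G).
Proof.
move=> hF hG; apply/imset2P/andP=> [[U V UF VG ->]|[UF VG]]; last first.
  exists (S :&: S7 k) (S :&: I4k k) => //.
  by rewrite -setIUr I4kE setUCr setIT.
have UX := hF _ UF; have VY := hG _ VG.
suff [-> ->] : (U :|: V) :&: S7 k = U /\ (U :|: V) :&: I4k k = V by [].
move: VY; rewrite I4kE => VY; rewrite !setIUl (setIidPl UX) (setIidPl VY).
have -> : V :&: S7 k = set0 by apply: disjoint_setI0; rewrite disjoints_subset.
have -> : U :&: ~: S7 k = set0.
  by apply: disjoint_setI0; rewrite disjoints_subset setCK.
by rewrite setU0 set0U.
Qed.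

Lemma in_B_line i S : 1 <= i <= 7 ->
  (S \in B k i) = (S :&: S7 k == L k i) && (#|S :&: I4k k| == 2 * k).
Proof.
move=> hi.
have -> : B k i = [set U :|: V | U in [set L k i],
                                V in subsets_of_size (I4k k) (2 * k)].
  rewrite imset2_set1l.
  by move: i hi => [|[|[|[|[|[|[|[|i]]]]]]]].
rewrite in_glue; first by rewrite !inE subsetIr.
- by move=> U; rewrite inE => /eqP->; exact: L_sub.
- by move=> V; rewrite inE => /andP[].
Qed.

Lemma in_glue_sized a b S :
  (S \in [set U :|: V | U in subsets_of_size (S7 k) a,
                        V in subsets_of_size (I4k k) b]) =
    (#|S :&: S7 k| == a) && (#|S :&: I4k k| == b).
Proof. by rewrite in_glue ?inE ?subsetIr // => U; rewrite inE => /andP[]. Qed.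

(** The families after the lines are numbered by decreasing trace, which puts
    traces of [t] points in the family of index [10 - t]. *)
Lemma in_B_small t S : t <= 2 ->
  (S \in B k (10 - t)) = (#|S :&: S7 k| == t) && (#|S :&: I4k k| + t == 2 * k + 3).
Proof.
case: t => [|[|[|]]] // _; last 2 first.
- by rewrite [LHS]in_glue_sized; lia.
- by rewrite [LHS]in_glue_sized; lia.
rewrite [LHS]inE I4kE -disjoints_subset -setI_eq0 -cards_eq0.
by have := card_split S; rewrite I4kE; lia.
Qed.

Definition fano_trace S : Prop :=
  (exists2 i, 1 <= i <= 7 & S :&: S7 k = L k i) \/ #|S :&: S7 k| <= 2.

(** The size of the part in [I4k] is forced by the size [2 * k + 3] of [S], so
    only the trace on the plane is left as a condition. *)
Lemma in_A S : S \in A k <-> #|S| = 2 * k + 3 /\ fano_trace S.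
Proof.
have AE : S \in A k <-> exists2 i, 1 <= i <= 10 & S \in B k i.
  rewrite /A (big_morph (fun T : {set {set _}} => S \in T)
    (fun T U => in_setU S T U) (in_set0 S)) big_has.
  split=> [/hasP[i] | [i hi iS]]; first by rewrite mem_index_iota; exists i.
  by apply/hasP; exists i; rewrite ?mem_index_iota.
rewrite AE -(card_split S); split=> [[i hi]|[hS [[i hi tr]|small]]].
- have [i7|i8] := leqP i 7.
    have hi7 : 1 <= i <= 7 by lia.
    rewrite in_B_line // => /andP[/eqP tr /eqP hY]; split.
      by rewrite tr card_L // hY; lia.
    by left; exists i.
  have -> : i = 10 - (10 - i) by lia.
  by rewrite in_B_small; last lia; move=> h; split; [|right]; lia.
- exists i; first lia.
  by move: hS; rewrite in_B_line // tr eqxx card_L //; lia.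
- by exists (10 - #|S :&: S7 k|); [|rewrite in_B_small //]; lia.
Qed.

(** * The two properties of the system *)

Lemma A_meet S0 S1 : S0 \in A k -> S1 \in A k -> S0 :&: S1 <> set0.
Proof.
have trace_le S : fano_trace S -> #|S :&: S7 k| <= 3.
  by case=> [[i hi ->]|]; [rewrite card_L | lia].
move=> /in_A[c0 t0] /in_A[c1 t1] S01.
have: #|S0 :&: I4k k| + #|S1 :&: I4k k| <= #|I4k k|.
  rewrite -cardsUI -setIIl S01 set0I cards0 addn0 -setIUl.
  exact/subset_leq_card/subsetIr.
rewrite card_I4k; have := card_split S0; have := card_split S1.
have := trace_le _ t0; have := trace_le _ t1.
case: t0 => [[i hi tr0]|]; last by lia.
case: t1 => [[j hj tr1]|]; last by lia.
have [x] := L_meet _ _ hi hj; rewrite -tr0 -tr1 !inE.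
by move=> /andP[x0 _] /andP[x1 _]; have := in_set0 x; rewrite -S01 inE x0 x1.
Qed.

Lemma A_disjoint S0 : #|S0| = 2 * k + 3 -> S0 \notin A k ->
  exists2 S1, S1 \in A k & S0 :&: S1 = set0.
Proof.
move=> c0 /negP nA.
have nT : ~ fano_trace S0 by move=> h; apply: nA; apply/in_A.
have cC : #|~: S0| = 2 * k + 4 by have := cardsC S0; rewrite card_ord; lia.
have cX : #|~: S0 :&: S7 k| = 7 - #|S0 :&: S7 k|.
  by have := cardsID S0 (S7 k); rewrite card_S7 setDE setIC [S7 k :&: _]setIC; lia.
(* The complement of [S0] is one point too large, so it remains to choose
   the point [x] to remove from it. *)
suff [x xC hx] : exists2 x, x \in ~: S0 & fano_trace (~: S0 :\ x).
  exists (~: S0 :\ x); last by rewrite setDE setIA setICr set0I.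
  by apply/in_A; split=> //; have := cardsD1 x (~: S0); rewrite xC; lia.
have big : 2 < #|S0 :&: S7 k| by rewrite ltnNge; apply/negP=> h; apply: nT; right.
have [t3|t4] := eqVneq #|S0 :&: S7 k| 3.
  have [i hi [tr|sL]] := L_avoid _ t3; first by case: nT; left; exists i.
  (* The complement has four points in the plane; [x] is the one off the
     line that avoids [S0]. *)
  have LC : L k i \subset ~: S0 :&: S7 k by rewrite subsetI sL L_sub.
  have /cards1P[x xE] : #|(~: S0 :&: S7 k) :\: L k i| == 1.
    by rewrite cardsD (setIidPr LC) card_L // cX t3.
  have : x \in (~: S0 :&: S7 k) :\: L k i by rewrite xE set11.
  rewrite !in_setD in_setI => /andP[_ /andP[xC _]].
  exists x => //; left; exists i => //.
  by rewrite setIDAC -xE setDDr setDv set0U; apply/setIidPr.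
(* Here the complement has at most three points in the plane; when it has any,
   [x] is taken among them. *)
have small : #|~: S0 :&: S7 k| <= 3 by lia.
have [e0|[x]] := set_0Vmem (~: S0 :&: S7 k).
  have /card_gt0P[x xC] : 0 < #|~: S0| by lia.
  by exists x => //; right; rewrite setIDAC e0 set0D cards0.
move=> xCX; have := cardsD1 x (~: S0 :&: S7 k); rewrite xCX => cD.
move: xCX; rewrite in_setI => /andP[xC _].
by exists x => //; right; rewrite setIDAC; lia.
Qed.

End Plane.

Theorem theorem1 (k : nat) (hk : 2 <= k) :
  @bicommutative_system (4 * k + 7) (2 * k + 3) (A k).
Proof.
split; [|exact: A_meet|].
  by apply/subsetP=> S /in_A[cS _]; rewrite inE subsetT cS eqxx.
by move=> S0; rewrite inE => /andP[_ /eqP c0]; exact: A_disjoint.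
Qed.
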